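(* Let $X_0,X_1,X_2,\dots$ be a Markov chain on a measurable space $(M,\mathcal{B})$ with one-step transition probability $P(x,\cdot)$ and $n$-step transition probabilities $P(n,x,\cdot)$, and suppose there exist a probability measure $m$ on $(M,\mathcal{B})$, an integer $n_0\ge1$ and a constant $C>0$ such that for all $x\in M$ and all $\Gamma\in\mathcal{B}$, $$P(x,\Gamma)\le C\,m(\Gamma)\quad\text{and}\quad P(n_0,x,\Gamma)\ge C^{-1}m(\Gamma).$$ Let $\mu$ be the unique invariant probability measure of this chain. Let $\ell\ge1$ and let $q_1,\dots,q_\ell$ be increasing integer-valued functions on the positive integers with $l\le q_1(l)<q_2(l)<\dots<q_\ell(l)$ and $$\lim_{l\to\infty}\big(q_{i+1}(l)-q_i(l)\big)=\infty\quad\text{for all } i=1,\dots,\ell-1.$$ Let $\Gamma_n\in\mathcal{B}$ be sets with $\lim_{n\to\infty}n(\mu(\Gamma_n))^\ell=\lambda>0$, and set $$S_n=\sum_{l=1}^n\prod_{j=1}^\ell \mathbb{I}_{\Gamma_n}(X_{q_j(l)}).$$ Then for any initial distribution $\nu$, under $P_\nu$ the random variables $S_n$ converge in distribution as $n\to\infty$ to a Poisson random variable with parameter $\lambda$, i.e. $\lim_{n\to\infty}P_\nu\{S_n=k\}=e^{-\lambda}\lambda^k/k!$ for all $k=0,1,2,\dots$.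
   Context: $\mathbb{I}_\Gamma$ denotes the indicator function of a set $\Gamma$. For $x\in M$, $P_x$ denotes the probability on the path space of the chain started at $X_0=x$; for a probability measure $\nu$ on $M$, $P_\nu=\int_M P_x\,d\nu(x)$. Under the stated (Doeblin-type) conditions the chain has a unique invariant probability measure $\mu$, i.e. $\int_M P(x,\Gamma)\,d\mu(x)=\mu(\Gamma)$ for all $\Gamma\in\mathcal{B}$. *)

(* Defs.v *)
From HB Require Import structures.
From mathcomp Require Import all_boot all_order all_algebra.
From mathcomp Require Import all_classical all_reals all_analysis.
Set Implicit Arguments. Unset Strict Implicit. Unset Printing Implicit Defensive.
Import Order.TTheory GRing.Theory Num.Theory.
Local Open Scope classical_set_scope.
Local Open Scope ring_scope.
Local Open Scope ereal_scope.

Fixpoint nstep (R : realType) (d : measure_display) (M : measurableType d)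
    (P : R.-pker M ~> M) (n : nat) (x : M) (G : set M) : \bar R :=
  match n with
  | O => \d_x G
  | S n' => \int[P x]_y nstep P n' y G
  end.

Definition invariant_prob (R : realType) (d : measure_display) (M : measurableType d)
    (P : R.-pker M ~> M) (mu : probability M R) : Prop :=
  forall G, measurable G -> \int[mu]_x P x G = mu G.

(* X_0, X_1, ... defined on the probability space (Om, Pr) is a Markov chain
   with transition kernel P and initial distribution nu, i.e. Pr = P_nu on the
   finite-dimensional cylinder sets:
   Pr(X_0 in A) = nu(A) and
   Pr(X_0 in A_0,...,X_n in A_n, X_{n+1} in B)
     = E[1{X_0 in A_0,...,X_n in A_n} P(X_n, B)]. *)
Definition markov_chain (R : realType) (d : measure_display) (M : measurableType d)
    (dO : measure_display) (Om : measurableType dO) (Pr : probability Om R)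
    (P : R.-pker M ~> M) (nu : probability M R) (X : nat -> Om -> M) : Prop :=
  [/\ forall n, measurable_fun [set: Om] (X n),
      forall A, measurable A -> Pr (X 0%N @^-1` A) = nu A &
      forall (n : nat) (A : nat -> set M) (B : set M),
        (forall i, measurable (A i)) -> measurable B ->
        Pr ((\bigcap_(i in `I_n.+1) X i @^-1` A i) `&` X n.+1 @^-1` B)
        = \int[Pr]_(w in \bigcap_(i in `I_n.+1) X i @^-1` A i) P (X n w) B].

(* S_n = sum_{l=1}^n prod_{j=1}^ell 1_{Gam_n}(X_{q_j(l)}); here j ranges over
   0..ell-1 (q j corresponds to q_{j+1} of the paper). *)
Definition Ssum (d : measure_display) (M : measurableType d) (Om : Type)
    (X : nat -> Om -> M) (ell : nat) (q : nat -> nat -> nat)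
    (Gam : nat -> set M) (n : nat) (w : Om) : nat :=
  (\sum_(1 <= l < n.+1) \prod_(j < ell) (X (q j l) w \in Gam n : nat))%N.

(* Main.v *)
Require Import Defs.
From HB Require Import structures.
From mathcomp Require Import all_boot all_order all_algebra.
From mathcomp Require Import all_classical all_reals all_analysis.
From mathcomp Require Import measurable_realfun ring lra zify.
Set Implicit Arguments.
Unset Strict Implicit.
Unset Printing Implicit Defensive.
Import Order.TTheory GRing.Theory Num.Theory.
Import numFieldNormedType.Exports.
Local Open Scope classical_set_scope.
Local Open Scope ring_scope.

(** The proof is by factorial moments.  The Doeblin conditions give
[m <= C mu] and [mu <= C m], hence [P(x, G) <= C^2 mu(G)] and
[P(n0, x, G) >= C^-2 mu(G)].  The last bound makes averaging against
[P(n0, x, .)] contract the distance of a function to its [mu]-mean by the factor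
[1 - C^-2]; applied to [P(1, ., G)] it gives geometric mixing relative to [mu(G)]:
[|P(n, x, G) - mu(G)| <= e_n mu(G)] with [e_n -> 0].

The [k]-th binomial moment of [S_n] is the sum, over the [k]-subsets [A] of
[{1, .., n}], of the probability that the chain is in [Gam n] at every time
[q_j(l)] with [l] in [A].  If these times are pairwise at distance at least [r],
this probability is [mu(Gam n)^(k ell)] up to a factor close to [1]; as there are
['C(n, k)] subsets, the limit is [lam^k / k!].  The other subsets are negligible:
each set of [u] distinct times has probability at most [(C^2 mu(Gam n))^u], a new
largest index always contributes at least one new time, and only boundedly many
new indices put a time within distance [r] of another one.  The Bonferroni
inequalities turn the convergence of binomial moments into that of
[P(S_n = k)]. *)

(** * Markov kernels *)

Section integral_bind.
Context (R : realType) (d1 d2 : measure_display)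
  (T1 : measurableType d1) (T2 : measurableType d2).
Variables (mu : {measure set T1 -> \bar R}) (mu_fin : (mu setT < +oo)%E).
Variable k : R.-fker T1 ~> T2.

(** Viewing [mu] as a kernel from a one-point space turns the mixture of the laws [k y] into a
    composition of kernels, to which [integral_kcomp] applies. *)
Definition kcst (_ : unit) : {measure set T1 -> \bar R} := mu.

Lemma measurable_kcst U : measurable U -> measurable_fun setT (kcst ^~ U).
Proof. by move=> mU; exact: measurable_cst. Qed.

HB.instance Definition _ := isKernel.Build _ _ _ _ _ kcst measurable_kcst.

Lemma kcst_uub : measure_fam_uub kcst.
Proof.
exists (fine (mu setT) + 1) => x; rewrite /kcst /=.
by rewrite -[ltLHS]fineK ?ge0_fin_numE// lte_fin ltrDl.
Qed.

HB.instance Definition _ := Kernel_isFinite.Build _ _ _ _ _ kcst kcst_uub.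

(** The second factor of a kernel composition starts from a product, so [k] is made to ignore the
    one-point coordinate. *)
Definition ksnd (xy : unit * T1) : {measure set T2 -> \bar R} := k xy.2.

Lemma measurable_ksnd U : measurable U -> measurable_fun setT (ksnd ^~ U).
Proof.
move=> mU; apply: (measurableT_comp (measurable_kernel k U mU)).
exact: measurable_snd.
Qed.

HB.instance Definition _ := isKernel.Build _ _ _ _ _ ksnd measurable_ksnd.

Lemma ksnd_uub : measure_fam_uub ksnd.
Proof. by have [r kr] := measure_uub k; exists r => -[x y]; exact: kr. Qed.

HB.instance Definition _ := Kernel_isFinite.Build _ _ _ _ _ ksnd ksnd_uub.

(** Fubini for mixtures: [m] and the composed kernel agree on measurable sets, hence have the same
    integrals. *)
Lemma ge0_integral_bind (m : {measure set T2 -> \bar R}) (f : T2 -> \bar R) :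
  (forall B, measurable B -> m B = \int[mu]_y k y B)%E ->
  (forall z, 0 <= f z)%E -> measurable_fun setT f ->
  (\int[m]_z f z = \int[mu]_y \int[k y]_z f z)%E.
Proof.
move=> mE f0 mf; rewrite -[RHS](integral_kcomp kcst ksnd tt f0 mf).
by apply: eq_measure_integral => B mB _; exact: mE.
Qed.

End integral_bind.

Section kernel_powers.
Context (R : realType) (d : measure_display) (M : measurableType d).
Variable P : R.-pker M ~> M.

(** Only a set function is given by [nstep]; here the same recursion carries the kernel structure,
    so that one can integrate against it. *)
Fixpoint kpow (n : nat) : R.-spker M ~> M :=
  match n with
  | 0 => kdirac (@measurable_id _ M setT)
  | n'.+1 => mkcomp_noparam P (kpow n')
  end.

Lemma kpowE n x B : kpow n x B = nstep P n x B.
Proof.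
elim: n x => [//|n IH] x /=.
by apply: eq_integral => y _; exact: IH.
Qed.

Lemma nstep_ge0 n x B : (0 <= nstep P n x B)%E.
Proof. by rewrite -kpowE. Qed.

Lemma nstep_le1 n x B : measurable B -> (nstep P n x B <= 1)%E.
Proof.
move=> mB; rewrite -kpowE; apply: le_trans (sprob_kernel_le1 (kpow n) x).
by apply: le_measure; rewrite ?inE.
Qed.

Lemma nstep_fin_num n x B : measurable B -> nstep P n x B \is a fin_num.
Proof.
move=> mB; rewrite ge0_fin_numE ?nstep_ge0//.
by rewrite (le_lt_trans (nstep_le1 n x mB))// ltry.
Qed.

Lemma measurable_nstep n B : measurable B ->
  measurable_fun setT (fun x => nstep P n x B).
Proof.
move=> mB; rewrite (_ : (fun _ => _) = (kpow n ^~ B)).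
  exact: measurable_kernel.
by apply/funext => x; rewrite kpowE.
Qed.

Lemma nstepT n x : nstep P n x setT = 1%E.
Proof.
elim: n x => [|n IH] x /=; first by rewrite diracT.
under eq_integral do rewrite IH.
by rewrite integral_cst// mul1e prob_kernel.
Qed.

Lemma nstep1 x B : measurable B -> nstep P 1 x B = P x B.
Proof.
move=> mB /=; under eq_integral do rewrite diracE -[_%:R]/(\1_B _).
by rewrite integral_indic// setIT.
Qed.

(** Chapman-Kolmogorov. The recursion peels off the first step, so the induction is on [n] with [k]
    fixed. *)
Lemma nstepD n k x B : measurable B ->
  nstep P (n + k) x B = (\int[kpow n x]_y nstep P k y B)%E.
Proof.
move=> mB; elim: n x => [|n IH] x.
  rewrite add0n /= integral_dirac//=; last exact: measurable_nstep.
  by rewrite diracT mul1e.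
rewrite addSn /=.
under eq_integral do rewrite IH.
apply/esym; apply: (@ge0_integral_bind _ _ _ _ _ (P x) _ (kpow n) (kpow n.+1 x)).
- by rewrite prob_kernel ltry.
- by [].
- by move=> z; exact: nstep_ge0.
- exact: measurable_nstep.
Qed.

End kernel_powers.

(** * Contraction and mixing *)

Section contraction.
Context (R : realType) (d : measure_display) (M : measurableType d).
Implicit Types (nu mu : {measure set M -> \bar R}) (f : M -> R).

Lemma le_bounded_fun f (b : R) : (forall y, `|f y| <= b) -> bounded_fun f.
Proof.
move=> fb; exists b; split; first exact: num_real.
by move=> x bx y _ /=; exact: le_trans (fb y) (ltW bx).
Qed.

Lemma bounded_fun_integrable nu f (c e : R) : (nu setT < +oo)%E ->
  measurable_fun setT f -> (forall y, `|f y - c| <= e) ->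
  nu.-integrable setT (EFin \o f).
Proof.
move=> nu1 mf fce; apply: measurable_bounded_integrable => //.
apply: (@le_bounded_fun _ (`|c| + e)) => y.
by have := ler_normD (f y - c) c; rewrite subrK; have := fce y; lra.
Qed.

Lemma Rintegral_shift nu f (a c e : R) : (nu setT = 1)%E ->
  measurable_fun setT f -> (forall y, `|f y - c| <= e) ->
  (\int[nu]_y (f y - a) = \int[nu]_y f y - a)%R.
Proof.
move=> nu1 mf fce; have nufin : (nu setT < +oo)%E by rewrite nu1 ltry.
rewrite RintegralB//; last 2 first.
- exact: bounded_fun_integrable fce.
- apply: (@bounded_fun_integrable _ _ a 0) => // y; by rewrite subrr normr0.
by rewrite Rintegral_cst// nu1 mulr1.
Qed.

Lemma le_Rintegral_minorized nu mu (dlt : R) f : 0 <= dlt ->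
  (nu setT < +oo)%E -> (mu setT < +oo)%E ->
  (forall B, measurable B -> (dlt%:E * mu B <= nu B)%E) ->
  measurable_fun setT f -> (forall y, 0 <= f y) -> bounded_fun f ->
  dlt * (\int[mu]_y f y) <= \int[nu]_y f y.
Proof.
move=> dlt0 nufin mufin dmn mf f0 bf.
have inu : nu.-integrable setT (EFin \o f) by exact: measurable_bounded_integrable.
have imu : mu.-integrable setT (EFin \o f) by exact: measurable_bounded_integrable.
rewrite -lee_fin EFinM /Rintegral !fineK; last 2 first.
- exact: integrable_fin_num inu.
- exact: integrable_fin_num imu.
have -> : dlt = (NngNum dlt0)%:num by [].
rewrite -ge0_integral_mscale//; last 2 first.
- exact/measurable_EFinP.
- by move=> x _; rewrite lee_fin.
apply: ge0_le_measure_integral => //.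
exact/measurable_EFinP.
Qed.

(** With [c] the [mu]-mean of [f], the functions [f - (c - e)] and [(c + e) - f] are nonnegative of
    [mu]-mean [e]. By minorization their [nu]-means are at least [dlt * e], which bounds the
    [nu]-mean of [f] on both sides. *)
Lemma Rintegral_contraction nu mu (dlt : R) f (e : R) : 0 <= dlt ->
  (nu setT = 1)%E -> (mu setT = 1)%E ->
  (forall B, measurable B -> (dlt%:E * mu B <= nu B)%E) ->
  measurable_fun setT f ->
  (forall y, `|f y - \int[mu]_z f z| <= e) ->
  `|\int[nu]_y f y - \int[mu]_z f z| <= (1 - dlt) * e.
Proof.
move=> dlt0 nu1 mu1 dmn mf; set c := Rintegral _ _ _ => fce.
have nufin : (nu setT < +oo)%E by rewrite nu1 ltry.
have mufin : (mu setT < +oo)%E by rewrite mu1 ltry.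
have fce' y : `|- f y - (- c)| <= e by rewrite -opprD normrN.
have mNf : measurable_fun setT (fun y => - f y) by exact: measurableT_comp.
have low : dlt * e <= \int[nu]_y f y - (c - e).
  rewrite -(@Rintegral_shift nu f _ c e)//.
  apply: le_trans (le_Rintegral_minorized dlt0 nufin mufin dmn _ _ _).
  - by rewrite (@Rintegral_shift mu f _ c e)// opprB addrCA subrr addr0.
  - exact: measurable_funB.
  - by move=> y; have := fce y; rewrite ler_norml; lra.
  - apply: (@le_bounded_fun _ (e + e)) => y.
    by have := fce y; rewrite !ler_norml; lra.
have high : dlt * e <= \int[nu]_y (- f y) - (- c - e).
  rewrite -(@Rintegral_shift nu (fun y => - f y) _ (- c) e)//.
  apply: le_trans (le_Rintegral_minorized dlt0 nufin mufin dmn _ _ _).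
  - rewrite (@Rintegral_shift mu (fun y => - f y) _ (- c) e)//.
    rewrite (_ : \int[mu]_y (- f y) = - c)%R.
      by rewrite opprB opprK [e + c]addrC addKr.
    under eq_Rintegral do rewrite -mulN1r.
    by rewrite RintegralZl ?mulN1r//; exact: bounded_fun_integrable fce.
  - exact: measurable_funB.
  - by move=> y; have := fce y; rewrite ler_norml; lra.
  - apply: (@le_bounded_fun _ (e + e)) => y.
    by have := fce y; rewrite !ler_norml; lra.
have : (\int[nu]_y (- f y) = - \int[nu]_y f y)%R.
  under eq_Rintegral do rewrite -mulN1r.
  by rewrite RintegralZl ?mulN1r//; exact: bounded_fun_integrable fce.
rewrite ler_norml; lra.
Qed.

End contraction.

Section mixing.
Context (R : realType) (d : measure_display) (M : measurableType d).
Variables (P : R.-pker M ~> M) (m mu : probability M R) (n0 : nat) (C : R).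
Hypothesis C_gt0 : 0 < C.
Hypothesis P_le : forall x B, measurable B -> (P x B <= C%:E * m B)%E.
Hypothesis P_ge :
  forall x B, measurable B -> ((C^-1)%:E * m B <= nstep P n0 x B)%E.
Hypothesis mu_inv : invariant_prob P mu.

Lemma integral_nstep n B : measurable B ->
  (\int[mu]_x nstep P n x B = mu B)%E.
Proof.
move=> mB; elim: n => [|n IH] /=.
  under eq_integral do rewrite diracE -[_%:R]/(\1_B _).
  by rewrite integral_indic// setIT.
rewrite -[RHS]IH; apply/esym.
apply: (@ge0_integral_bind _ _ _ _ _ mu _ P mu).
- exact: le_lt_trans (probability_le1 mu measurableT) (ltry _).
- by move=> A mA; rewrite mu_inv.
- by move=> z; exact: nstep_ge0.
- exact: measurable_nstep.
Qed.

(** The upper Doeblin bound is integrated against the invariant [mu]. *)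
Lemma mu_le_m B : measurable B -> (mu B <= C%:E * m B)%E.
Proof.
move=> mB; rewrite -mu_inv//.
apply: (@le_trans _ _ (\int[mu]_x (C%:E * m B))%E).
  apply: ge0_le_integral => //.
  - exact: measurable_kernel.
  - by move=> x _; exact: P_le.
by rewrite integral_cst// [X in (_ * X)%E](probability_setT mu) mule1.
Qed.

(** The lower Doeblin bound is integrated against [mu], which is also invariant under [n0] steps. *)
Lemma m_le_mu B : measurable B -> (m B <= C%:E * mu B)%E.
Proof.
move=> mB; have : ((C^-1)%:E * m B <= mu B)%E.
  rewrite -(integral_nstep n0 mB).
  apply: (@le_trans _ _ (\int[mu]_x ((C^-1)%:E * m B))%E).
    by rewrite integral_cst// [X in (_ <= _ * X)%E](probability_setT mu) mule1.
  apply: ge0_le_integral => //.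
  - by move=> x _; rewrite mule_ge0// lee_fin invr_ge0 ltW.
  - exact: measurable_nstep.
  - by move=> x _; exact: P_ge.
move=> /(lee_wpmul2l (_ : 0 <= C%:E)%E); rewrite lee_fin ltW// => /(_ isT).
by rewrite muleA -EFinM divff ?mul1e// gt_eqF.
Qed.

Lemma P_le_mu x B : measurable B -> (P x B <= (C ^+ 2)%:E * mu B)%E.
Proof.
move=> mB; apply: le_trans (P_le x mB) _.
by rewrite expr2 EFinM -muleA lee_wpmul2l ?lee_fin ?(ltW C_gt0)// m_le_mu.
Qed.

Lemma C_ge1 : 1 <= C.
Proof.
have := mu_le_m measurableT.
by rewrite !probability_setT mule1 lee_fin.
Qed.

Let dlt := (C ^+ 2)^-1.

Lemma kpow_ge x B : measurable B -> (dlt%:E * mu B <= kpow P n0 x B)%E.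
Proof.
move=> mB; rewrite kpowE; apply: le_trans (P_ge x mB).
rewrite /dlt expr2 invfM EFinM -muleA lee_wpmul2l ?lee_fin ?invr_ge0 ?(ltW C_gt0)//.
have := mu_le_m mB.
move=> /(lee_wpmul2l (_ : 0 <= (C^-1)%:E)%E).
rewrite lee_fin invr_ge0 ltW// => /(_ isT).
by rewrite muleA -EFinM mulVf ?mul1e// gt_eqF.
Qed.

Variable G : set M.
Hypothesis mG : measurable G.

Let h n y : R := fine (nstep P n y G).

Lemma measurable_fine_nstep n : measurable_fun setT (h n).
Proof. by apply: measurableT_comp => //; exact: measurable_nstep. Qed.

Lemma Rintegral_kpow n k x : h (n + k) x = (\int[kpow P n x]_y h k y)%R.
Proof.
rewrite /h nstepD// /Rintegral; congr fine; apply: eq_integral => y _.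
by rewrite fineK// nstep_fin_num.
Qed.

Lemma Rintegral_fine_nstep n : (\int[mu]_y h n y)%R = fine (mu G).
Proof.
rewrite /Rintegral -(integral_nstep n mG); congr fine; apply: eq_integral => y _.
by rewrite fineK// nstep_fin_num.
Qed.

(** Prepending [n0] steps averages [h k] against a law minorized by [dlt * mu], and [h k] has
    [mu]-mean [mu G]. *)
Lemma nstep_dist_step k (e : R) x : (forall y, `|h k y - fine (mu G)| <= e) ->
  `|h (n0 + k) x - fine (mu G)| <= (1 - dlt) * e.
Proof.
move=> he; rewrite Rintegral_kpow -(Rintegral_fine_nstep k).
apply: Rintegral_contraction => //.
- by rewrite invr_ge0 exprn_ge0// ltW.
- by rewrite kpowE nstepT.
- exact: probability_setT.
- by move=> B mB; exact: kpow_ge.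
- exact: measurable_fine_nstep.
- by move=> y; rewrite Rintegral_fine_nstep.
Qed.

Lemma nstep_dist_mono k (e : R) n x : (forall y, `|h k y - fine (mu G)| <= e) ->
  `|h (n + k) x - fine (mu G)| <= e.
Proof.
move=> he; rewrite Rintegral_kpow -(Rintegral_fine_nstep k).
(* Averaging against any probability does not increase the distance: this is the contraction with
   [dlt = 0], whose minorization is trivial. *)
rewrite -[leRHS]mul1r -[X in X * e]subr0.
apply: Rintegral_contraction => //.
- by rewrite kpowE nstepT.
- exact: probability_setT.
- by move=> B mB; rewrite mul0e.
- exact: measurable_fine_nstep.
- by move=> y; rewrite Rintegral_fine_nstep.
Qed.

(** Start of the mixing induction. One step is taken because [h 0] is an indicator, whose distance
    to the mean is not of order [mu G]. *)
Lemma nstep1_dist x : `|h 1 x - fine (mu G)| <= C ^+ 2 * fine (mu G).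
Proof.
have h1 : h 1 x = fine (P x G) by rewrite /h nstep1.
have Pfin : P x G \is a fin_num by rewrite -nstep1// nstep_fin_num.
have mufin : mu G \is a fin_num by exact: fin_num_measure.
have hle : fine (P x G) <= C ^+ 2 * fine (mu G).
  by rewrite -lee_fin EFinM !fineK// P_le_mu.
have hge : 0 <= fine (P x G) by rewrite fine_ge0.
have mge : 0 <= fine (mu G) by rewrite fine_ge0.
have C2 : 1 <= C ^+ 2 by rewrite exprn_ege1// C_ge1.
have : fine (mu G) <= C ^+ 2 * fine (mu G) by rewrite ler_peMl.
rewrite h1 ler_norml; lra.
Qed.

(** The strict inequality leaves room for [k] contracting blocks of length [n0] followed by one last
    step; the surplus steps do no harm. *)
Lemma nstep_mixing k n x : (k * n0 < n)%N ->
  `|h n x - fine (mu G)| <= (1 - dlt) ^+ k * C ^+ 2 * fine (mu G).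
Proof.
move=> kn; rewrite -(subnK kn); apply: nstep_dist_mono => {n kn x} x.
elim: k x => [|k IH] x; first by rewrite mul0n expr0 mul1r; exact: nstep1_dist.
rewrite mulSn -addnS exprS -!(mulrA (1 - dlt)).
exact: nstep_dist_step IH.
Qed.

End mixing.

(** * Visiting a set at prescribed times *)

Lemma ge0_integral_mrestr (R : realType) (d : measure_display)
    (T : measurableType d) (mu : {measure set T -> \bar R}) (D : set T)
    (mD : measurable D) (f : T -> \bar R) :
  (forall x, 0 <= f x)%E -> measurable_fun setT f ->
  (\int[mrestr mu mD]_x f x = \int[mu]_(x in D) f x)%E.
Proof.
move=> f0 mf; rewrite -(setUv D) ge0_integral_setU//.
- rewrite (@eq_measure_integral _ _ _ D mu (mrestr mu mD)); last first.
    by move=> A mA AD; rewrite /= /mrestr (setIidl AD).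
  rewrite (@eq_measure_integral _ _ _ (~` D) mzero (mrestr mu mD)); last first.
    move=> A mA AD; rewrite /= /mrestr /mzero.
    by rewrite (disjoints_subset A D).2// measure0.
  by rewrite integral_measure_zero adde0.
- exact: measurableC.
- exact: measurable_funTS.
- by rewrite disj_set2E setICr.
Qed.

Section markov.
Context (R : realType) (d : measure_display) (M : measurableType d)
  (dO : measure_display) (Om : measurableType dO).
Variables (Pr : probability Om R) (P : R.-pker M ~> M) (nu : probability M R)
  (X : nat -> Om -> M).
Hypothesis mcX : markov_chain Pr P nu X.

Let mX n : measurable_fun [set: Om] (X n). Proof. by have [] := mcX. Qed.

Definition cyl (A : nat -> set M) n := \bigcap_(i in `I_n.+1) X i @^-1` A i.

Lemma measurable_cyl A n : (forall i, measurable (A i)) -> measurable (cyl A n).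
Proof.
move=> mA; apply: bigcap_measurable => [|i _]; first by exists 0%N.
by rewrite -[_ @^-1` _]setTI; exact: mX.
Qed.

(** Restricted to the cylinder, the law of [X n.+1] is the mixture of [P] over the law of [X n];
    this extends the Markov property from sets to functions. *)
Lemma markov_integral n A (f : M -> \bar R) : (forall i, measurable (A i)) ->
  (forall x, 0 <= f x)%E -> measurable_fun setT f ->
  (\int[Pr]_(w in cyl A n) f (X n.+1 w) =
   \int[Pr]_(w in cyl A n) \int[P (X n w)]_y f y)%E.
Proof.
move=> mA f0 mf; have mE := measurable_cyl n mA.
have mP g : (forall x, 0 <= g x)%E -> measurable_fun setT g ->
    measurable_fun setT (fun x => \int[P x]_y g y)%E.
  move=> g0 mg; apply: measurable_fun_integral_kernel => // U mU.
  exact: measurable_kernel.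
(* The sub-law of [X k] on the cylinder is the image of the restricted [Pr]. *)
have law k : exists rho : {measure set M -> \bar R},
    (forall B, rho B = Pr (X k @^-1` B `&` cyl A n)) /\
    (forall g, (forall x, 0 <= g x)%E -> measurable_fun setT g ->
      (\int[rho]_y g y = \int[Pr]_(w in cyl A n) g (X k w))%E).
  unshelve eexists (pushforward (mrestr Pr mE) (X k)); first exact: mX.
  split=> // g g0 mg; rewrite ge0_integral_pushforward//.
  rewrite preimage_setT ge0_integral_mrestr//; last exact: measurableT_comp.
  by move=> x; exact: g0.
have [rho [rhoB rhoE]] := law n; have [rho' [rhoB' rhoE']] := law n.+1.
rewrite -rhoE'// -(rhoE (fun x => \int[P x]_y f y)%E); last 2 first.
- by move=> x; exact: integral_ge0.
- exact: mP.
apply: (@ge0_integral_bind _ _ _ _ _ rho _ P rho') => //.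
- rewrite rhoB preimage_setT setTI.
  exact: le_lt_trans (probability_le1 Pr mE) (ltry _).
- move=> B mB; rewrite rhoE//; last exact: measurable_kernel.
  have [_ _ H] := mcX; rewrite -H//.
  by rewrite rhoB' setIC.
Qed.

(** Since nothing is required after time [n], the cylinder up to [n] is also the one up to [n.+1],
    and the induction on [k] can move one step forward. *)
Lemma markov_nstep k n A B : (forall i, measurable (A i)) -> measurable B ->
  (forall i, (n < i)%N -> A i = setT) ->
  Pr (cyl A n `&` X (n + k) @^-1` B) =
  (\int[Pr]_(w in cyl A n) nstep P k (X n w) B)%E.
Proof.
move=> mA mB; elim: k n => [|k IH] n AT.
  rewrite addn0 /=.
  under eq_integral do rewrite diracE -[_%:R]/(\1_(X n @^-1` B) _).
  rewrite integral_indic; [by rewrite setIC|exact: measurable_cyl|].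
  by rewrite -[_ @^-1` _]setTI; exact: mX.
rewrite /= -markov_integral//; last 2 first.
- by move=> x; exact: nstep_ge0.
- exact: measurable_nstep.
have -> : cyl A n = cyl A n.+1.
  apply/seteqP; split => w Ew i /= ilt; last exact: (Ew i (ltnW ilt)).
  have [//|ni] := leqP i n; first exact: Ew.
  by rewrite AT.
by rewrite addnS -addSn IH// => i ni; rewrite AT// ltnW.
Qed.

Variables (G : set M) (mG : measurable G).

Definition hit (T : seq nat) := [set w | forall t, t \in T -> G (X t w)].

Lemma measurable_hit T : measurable (hit T).
Proof.
rewrite (_ : hit T = \bigcap_(t in [set` T]) X t @^-1` G).
  by apply: fin_bigcap_measurable => // t _; rewrite -[_ @^-1` _]setTI; exact: mX.
by apply/seteqP; split => w.
Qed.

Lemma eq_hit T1 T2 : T1 =i T2 -> hit T1 = hit T2.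
Proof.
by move=> e; apply/seteqP; split => w H t; [rewrite -e|rewrite e]; exact: H.
Qed.

Lemma hit_cons_nstep n k T : all (geq n) T ->
  Pr (hit (n + k :: T)) = (\int[Pr]_(w in hit T) nstep P k (X n w) G)%E.
Proof.
(* The event [hit T] becomes a cylinder by imposing no constraint at times outside [T]. *)
move=> /allP Tn; pose A i := if i \in T then G else setT.
have -> : hit T = cyl A n.
  apply/seteqP; split => w Hw.
    by move=> i _ /=; rewrite /A; case: ifP => // /Hw.
  by move=> t tT; have := Hw t (Tn _ tT); rewrite /A /= tT.
rewrite -markov_nstep//.
- congr (Pr _); apply/seteqP; split => w.
    move=> Hw; split; last by apply: Hw; rewrite inE eqxx.
    by move=> i _ /=; rewrite /A; case: ifP => // iT; apply: Hw; rewrite inE iT orbT.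
  move=> [Ew wG] t; rewrite inE => /orP[/eqP -> //|tT].
  by have := Ew t (Tn _ tT); rewrite /A /= tT.
- by move=> i; rewrite /A; case: ifP.
- move=> i ni; rewrite /A; case: ifP => // iT.
  by have := Tn _ iT; rewrite /= leqNgt ni.
Qed.

Definition phit T : R := fine (Pr (hit T)).

Lemma phit_ge0 T : 0 <= phit T. Proof. exact: fine_ge0. Qed.

Lemma phit_cons_le n k T (b : R) : all (geq n) T ->
  (forall y, fine (nstep P k y G) <= b) -> phit (n + k :: T) <= b * phit T.
Proof.
move=> Tn hb; rewrite -lee_fin EFinM !fineK; last 2 first.
- by apply: fin_num_measure; exact: measurable_hit.
- by apply: fin_num_measure; exact: measurable_hit.
rewrite hit_cons_nstep// -integral_cst//; last exact: measurable_hit.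
apply: ge0_le_integral => //.
- exact: measurable_hit.
- by move=> w _; exact: nstep_ge0.
- apply: measurable_funTS.
  exact: (measurableT_comp (measurable_nstep P k mG) (mX n)).
- by move=> w _; rewrite -[leLHS]fineK ?nstep_fin_num// lee_fin.
Qed.

Lemma phit_cons_ge n k T (a : R) : all (geq n) T ->
  (forall y, a <= fine (nstep P k y G)) -> a * phit T <= phit (n + k :: T).
Proof.
(* A negative [a] must be allowed: the lemma is later used with [(1 - e) * u], where [e] may exceed
   1. *)
move=> Tn ha; have [a0|/ltW a0] := leP 0 a; last first.
  by rewrite (@le_trans _ _ 0) ?phit_ge0// mulr_le0_ge0// phit_ge0.
rewrite -lee_fin EFinM !fineK; last 2 first.
- by apply: fin_num_measure; exact: measurable_hit.
- by apply: fin_num_measure; exact: measurable_hit.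
rewrite hit_cons_nstep// -integral_cst//; last exact: measurable_hit.
apply: ge0_le_integral => //.
- exact: measurable_hit.
- apply: measurable_funTS.
  exact: (measurableT_comp (measurable_nstep P k mG) (mX n)).
- by move=> w _; rewrite -[leRHS]fineK ?nstep_fin_num// lee_fin.
Qed.

Lemma phit_nil : phit [::] = 1.
Proof.
rewrite /phit (_ : hit [::] = setT) ?probability_setT//.
by apply/seteqP; split.
Qed.

(** With the distinct times in decreasing order, each is reached from its predecessor instant by one
    step, which costs a factor [x]. Time 0 is excluded because the initial law satisfies no such
    bound. *)
Lemma phit_le (x : R) T : (forall y, fine (nstep P 1 y G) <= x) ->
  all (leq 1) T -> phit T <= x ^+ size (undup T).
Proof.
move=> hx T1.
have x0 : 0 <= x.
  by apply: le_trans (hx point); rewrite fine_ge0// nstep_ge0.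
rewrite /phit (eq_hit (T2 := sort geq (undup T))); last first.
  by move=> t; rewrite mem_sort mem_undup.
rewrite -(size_sort geq (undup T)).
have : sorted gtn (sort geq (undup T)).
  rewrite gtn_sorted_uniq_geq sort_uniq undup_uniq/=.
  by apply: sort_sorted => a b /=; exact: leq_total.
have : all (leq 1) (sort geq (undup T)).
  by apply/allP => t; rewrite mem_sort mem_undup => /(allP T1).
elim: (sort _ _) => [_ _|t s IH]; first by rewrite -/(phit [::]) phit_nil expr0.
move=> /= /andP[t1 s1]; rewrite (path_sortedE (rev_trans ltn_trans)).
move=> /andP[ts ss].
rewrite exprS (le_trans _ (ler_wpM2l x0 (IH s1 ss)))//.
case: t t1 ts => // t _ ts; rewrite -addn1; apply: phit_cons_le => //.
Qed.

Definition far r (a b : nat) := (a + r <= b)%N || (b + r <= a)%N.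

(** The lower bound [r] on the times is a gap from time 0, so that the initial law is forgotten
    before the first visit. *)
Definition spaced r (T : seq nat) := all (leq r) T && pairwise (far r) T.

Lemma far_sym r : symmetric (far r).
Proof. by move=> a b; rewrite /far orbC. Qed.

Lemma perm_spaced r T1 T2 : perm_eq T1 T2 -> spaced r T1 -> spaced r T2.
Proof.
move=> p /andP[T1r T1f]; apply/andP; split; first by rewrite -(perm_all _ p).
(* Permutations are generated by block exchanges, under which the symmetric relation [far r] stays
   pairwise. *)
apply: (catCA_perm_ind (P := fun s => is_true (pairwise (far r) s)) _ p T1f) => s1 s2 s3.
rewrite !pairwise_cat !allrel_catr => /and3P[/andP[s12 s13] p1 /and3P[s23 p2 p3]].
rewrite s13 s23 p1 p2 p3 !andbT allrelC.
by rewrite (eq_allrel (r' := far r))// => a b; exact: far_sym.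
Qed.

(** Taking the times in decreasing order, each gap of at least [r] contributes a factor between
    [(1 - e) * u] and [(1 + e) * u]; the relative errors accumulate to at most
    [(1 + e) ^+ size T - 1]. *)
Lemma phit_spaced r (u e : R) T : 0 <= u -> 0 <= e ->
  (0 < r)%N ->
  (forall k y, (r <= k)%N -> `|fine (nstep P k y G) - u| <= e * u) ->
  spaced r T ->
  `|phit T - u ^+ size T| <= ((1 + e) ^+ size T - 1) * u ^+ size T.
Proof.
move=> u0 e0 r0 mix sepT.
have pT : perm_eq T (sort geq T) by rewrite perm_sym perm_sort.
rewrite /phit (eq_hit (T2 := sort geq T)); last exact: perm_mem.
rewrite (perm_size pT) -/(phit _).
have : sorted geq (sort geq T) by apply: sort_sorted => a b /=; exact: leq_total.
move: (perm_spaced pT sepT).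
elim: (sort _ _) => [_ _|t s IH].
  by rewrite phit_nil !expr0 subrr normr0 mul0r.
rewrite /spaced /= => /andP[/andP[rt rs] /andP[fs ps]].
rewrite (path_sortedE (rev_trans leq_trans)) => /andP[ts ss].
have := IH _ ss; rewrite /spaced rs ps => /(_ isT) {}IH.
(* As [t] is the latest time and [r > 0], being far from [t] can only mean being at least [r]
   earlier. *)
have sn : all (geq (t - r)%N) s.
  apply/allP => a sa; have := allP ts _ sa; have := allP fs _ sa.
  by rewrite /far /=; move: rt r0; lia.
have hi : phit (t :: s) <= (1 + e) * u * phit s.
  rewrite -[t in phit (t :: _)](subnK rt); apply: phit_cons_le => // y.
  by have := mix r y (leqnn r); rewrite ler_norml; lra.
have lo : (1 - e) * u * phit s <= phit (t :: s).
  rewrite -[t in phit (t :: _)](subnK rt); apply: phit_cons_ge => // y.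
  by have := mix r y (leqnn r); rewrite ler_norml; lra.
rewrite !exprS; set p := phit (t :: s) in hi lo *; set p' := phit s in IH hi lo *.
have p'0 : 0 <= p' by exact: phit_ge0.
set v := u ^+ size s in IH *; set f := (1 + e) ^+ size s in IH *.
have v0 : 0 <= v by exact: exprn_ge0.
have f1 : 1 <= f by rewrite exprn_ege1// lerDl.
have A1 : u * `|p' - v| <= u * ((f - 1) * v) by rewrite ler_wpM2l.
have p'le : p' <= f * v by have := IH; rewrite ler_norml; lra.
have A2 : e * u * p' <= e * u * (f * v) by rewrite ler_wpM2l// mulr_ge0.
have A3 : `|p - u * p'| <= e * u * p' by rewrite ler_norml; nra.
(* The new error splits into that of the last gap and [u] times the error inherited from [s]. *)
have := ler_normD (p - u * p') (u * (p' - v)).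
rewrite normrM (ger0_norm u0).
have -> : p - u * p' + u * (p' - v) = p - u * v by ring.
move: A1 A2 A3; move: `|p' - v| `|p - u * p'| `|p - u * v| => *; nra.
Qed.

End markov.

(** * Sets of indices and their visiting times *)

(* [subs n k] lists the [k]-subsets of [{1, .., n}] as decreasing sequences. *)
Fixpoint subs (n k : nat) : seq (seq nat) :=
  match n, k with
  | _, 0 => [:: [::]]
  | 0, _.+1 => [::]
  | n'.+1, k'.+1 => subs n' k'.+1 ++ [seq n'.+1 :: A | A <- subs n' k']
  end.

Lemma size_subs n k : size (subs n k) = 'C(n, k).
Proof.
elim: n k => [|n IH] [|k] //=.
by rewrite size_cat size_map !IH binS.
Qed.

Lemma subs_size n k A : A \in subs n k -> size A = k.
Proof.
elim: n k A => [|n IH] [|k] A //=; rewrite ?inE; try by move=> /eqP ->.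
rewrite mem_cat => /orP[/IH//|/mapP[B /IH <- ->] //].
Qed.

Lemma subs_range n k A : A \in subs n k -> all (fun l => 0 < l <= n)%N A.
Proof.
elim: n k A => [|n IH] [|k] A //=; rewrite ?inE; try by move=> /eqP ->.
rewrite mem_cat => /orP[/IH|/mapP[B /IH BA ->] /=].
  by apply: sub_all => l /andP[-> /leqW].
by rewrite leqnn; apply: sub_all BA => l /andP[-> /leqW].
Qed.

(** Both sides count the [k]-subsets of the indices at which [y] holds; the induction is Pascal's
    rule. *)
Lemma sum_prod_subs (y : nat -> bool) n k :
  (\sum_(A <- subs n k) \prod_(l <- A) (y l : nat) =
   'C(\sum_(1 <= l < n.+1) (y l : nat), k))%N.
Proof.
elim: n k => [|n IH] [|k] /=.
- by rewrite big_seq1 big_nil bin0.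
- by rewrite big_nil big_geq// bin0n.
- by rewrite big_seq1 big_nil bin0.
rewrite big_cat big_map/= IH; under [X in (_ + X)%N = _]eq_bigr do rewrite big_cons.
rewrite -big_distrr/= IH [in RHS]big_nat_recr//=.
by case: (y n.+1) => /=; rewrite ?mul1n ?mul0n ?addn0 ?addn1 ?binS.
Qed.

(** A set of size [k.+1] is its largest element added to a set of size [k]. This yields recursions
    in [k] at fixed [n]. *)
Lemma le_sum_subsS (R : numDomainType) (F : seq nat -> R) n k :
  (forall A, 0 <= F A) ->
  \sum_(A <- subs n k.+1) F A <=
  \sum_(A <- subs n k) \sum_(1 <= l < n.+1 | all (gtn l) A) F (l :: A).
Proof.
move=> F0; elim: n k => [|n IH] k /=.
  by rewrite big_nil; apply: sumr_ge0 => A _; apply: sumr_ge0.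
rewrite big_cat big_map/=.
have H : \sum_(A <- subs n k.+1) F A + \sum_(A <- subs n k) F (n.+1 :: A) <=
    \sum_(A <- subs n k) \sum_(1 <= l < n.+2 | all (gtn l) A) F (l :: A).
  apply: le_trans (lerD (IH k) (lexx _)) _.
  rewrite -big_split/= big_seq [leRHS]big_seq; apply: ler_sum => A /subs_range Ar.
  rewrite [leRHS]big_mkcond big_nat_recr//= -big_mkcond/= ifT//.
  by apply: sub_all Ar => l /andP[_].
case: k H {IH} => [|k] H; first by case: n H.
rewrite big_cat/=; apply: le_trans H _; rewrite lerDl.
by apply: sumr_ge0 => A _; apply: sumr_ge0.
Qed.

Section times.
Variables (ell : nat) (q : nat -> nat -> nat).
Hypothesis ell_gt0 : (0 < ell)%N.
Hypothesis q_incr : forall j, (j < ell)%N ->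
  forall a b, (0 < a)%N -> (a < b)%N -> (q j a < q j b)%N.
Hypothesis q0_ge : forall l, (0 < l)%N -> (l <= q 0 l)%N.
Hypothesis q_lt : forall j l, (0 < l)%N -> (j.+1 < ell)%N -> (q j l < q j.+1 l)%N.
Hypothesis q_gap : forall j, (j.+1 < ell)%N -> forall N : nat, exists L : nat,
  forall l, (L <= l)%N -> (N <= q j.+1 l - q j l)%N.

Definition times l := [seq q j l | j <- iota 0 ell].
Definition times_of (A : seq nat) := flatten [seq times l | l <- A].
Definition ntimes A := size (undup (times_of A)).

Lemma size_times l : size (times l) = ell.
Proof. by rewrite size_map size_iota. Qed.

Lemma size_times_of A : size (times_of A) = (size A * ell)%N.
Proof. by elim: A => //= l A IH; rewrite size_cat size_times IH mulSn. Qed.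

Lemma q_mono i j l : (0 < l)%N -> (i <= j < ell)%N -> (q i l <= q j l)%N.
Proof.
move=> l0 /andP[]; elim: j => [|j IH]; first by rewrite leqn0 => /eqP ->.
rewrite leq_eqVlt => /orP[/eqP -> //|ij] jl.
by rewrite (leq_trans (IH ij (ltnW jl)))// ltnW// q_lt.
Qed.

Lemma times_ge l t : (0 < l)%N -> t \in times l -> (l <= t)%N.
Proof.
move=> l0 /mapP[j]; rewrite mem_iota => jl ->.
by rewrite (leq_trans (q0_ge l0))// q_mono//=; move: jl; rewrite add0n.
Qed.

Lemma times_of_gt0 A : all (leq 1) A -> all (leq 1) (times_of A).
Proof.
move=> /allP A0; apply/allP => t /flattenP[s /mapP[l lA ->]] tl.
exact: leq_trans (A0 _ lA) (times_ge (A0 _ lA) tl).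
Qed.

Lemma ntimes_cons l A :
  ntimes (l :: A) =
  (size [seq t <- undup (times l) | t \notin times_of A] + ntimes A)%N.
Proof. by rewrite /ntimes /= undup_cat size_cat. Qed.

Lemma ntimes_le A : (ntimes A <= size A * ell)%N.
Proof. by rewrite -size_times_of; exact: size_undup. Qed.

(* The latest time of the largest index is always new. *)
Lemma ntimes_cons_gt l A : (0 < l)%N -> all (leq 1) A -> all (gtn l) A ->
  (ntimes A < ntimes (l :: A))%N.
Proof.
move=> l0 /allP A0 /allP Al; rewrite ntimes_cons -[leqLHS]add1n leq_add2r.
have qin : q ell.-1 l \in times l.
  by apply/mapP; exists ell.-1 => //; rewrite mem_iota add0n ltn_predL.
rewrite -has_predT has_filter filter_predT -has_filter; apply/hasP.
exists (q ell.-1 l); first by rewrite mem_undup.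
apply/negP => /flattenP[s /mapP[a aA ->] /mapP[j]].
rewrite mem_iota => /andP[_ jl] qE.
(* For [a < l], [q j a <= q ell.-1 a < q ell.-1 l], so no earlier index produces this time. *)
have := q_mono (A0 _ aA) (_ : (j <= ell.-1 < ell)%N).
have := q_incr (_ : (ell.-1 < ell)%N) (A0 _ aA) (Al _ aA).
by rewrite qE; move: jl ell_gt0; lia.
Qed.

Lemma spaced_cat r s t : spaced r (s ++ t) =
  [&& spaced r s, allrel (far r) s t & spaced r t].
Proof.
rewrite /spaced all_cat pairwise_cat.
by do !case: (all _ _); do !case: (pairwise _ _) => //=; rewrite ?andbF ?andbT.
Qed.

(** Exactly what adding [l] requires in order to preserve spacing, see [spaced_times_of_cons]. *)
Definition compatible r l A :=
  spaced r (times l) && allrel (far r) (times l) (times_of A).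

Lemma spaced_times_of_cons r l A : spaced r (times_of (l :: A)) =
  compatible r l A && spaced r (times_of A).
Proof. by rewrite /= spaced_cat andbA. Qed.

Lemma farxx r t : (0 < r)%N -> far r t t = false.
Proof. by rewrite /far; lia. Qed.

Lemma ntimes_compatible r l A : (0 < r)%N -> compatible r l A ->
  ntimes (l :: A) = (ell + ntimes A)%N.
Proof.
move=> r0 /andP[/andP[_ pf] /allrelP af]; rewrite ntimes_cons; congr addn.
rewrite undup_id; last by apply: pairwise_uniq pf => t; exact: farxx.
rewrite (_ : [seq t <- times l | t \notin times_of A] = times l) ?size_times//.
apply/all_filterP/allP => t tl; apply/negP => tA.
by have := af _ _ tl tA; rewrite farxx.
Qed.

Lemma q_gap_uniform r : exists L, forall l j, (L <= l)%N -> (j.+1 < ell)%N ->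
  (r <= q j.+1 l - q j l)%N.
Proof.
suff [L HL] : exists L, forall l j, (L <= l)%N -> (j < ell)%N -> (j.+1 < ell)%N ->
    (r <= q j.+1 l - q j l)%N.
  by exists L => l j Ll jl; apply: HL => //; exact: ltnW.
(* Only the bound on [j] varies in the induction; the threshold becomes the maximum of those for the
   individual gaps. *)
elim: {1}ell => [|e [L HL]]; first by exists 0%N.
have [el|el] := ltnP e.+1 ell; last first.
  exists L => l j Ll je jl; apply: HL => //; move: je jl el; lia.
have [L' HL'] := q_gap el r.
exists (maxn L L') => l j; rewrite geq_max => /andP[Ll L'l].
rewrite ltnS leq_eqVlt => /orP[/eqP -> _|je jl]; first exact: HL'.
exact: HL.
Qed.

Lemma spaced_times r : exists L, forall l, (L <= l)%N -> spaced r (times l).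
Proof.
have [L HL] := q_gap_uniform r; exists (maxn L (maxn r 1)) => l.
rewrite !geq_max => /and3P[Ll rl l0]; apply/andP; split.
  by apply/allP => t /(times_ge l0); exact: leq_trans.
have qr i j : (i < j < ell)%N -> (q i l + r <= q j l)%N.
  move=> /andP[ij jl]; case: j ij jl => // j ij jl.
  have ijl : (i <= j < ell)%N by rewrite -ltnS ij ltnW.
  have := HL l j Ll jl; have := q_mono l0 ijl; have := q_lt l0 jl; lia.
rewrite /times pairwise_map.
have : pairwise ltn (iota 0 ell).
  by rewrite -(sorted_pairwise ltn_trans) iota_ltn_sorted.
apply: (@sub_in_pairwise _ [in iota 0 ell]); last exact/allP.
move=> i j; rewrite !mem_iota /= => _ jl ij.
by rewrite /far qr// ij.
Qed.

(** By injectivity of [q j] on positive integers, at most as many indices occur as there are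
    integers in a window of length [r.*2] around [t]. If [t < r] the window starts at 0 and still
    contains every time near [t]. *)
Lemma sum_not_far r j t n : (j < ell)%N ->
  (\sum_(1 <= l < n.+1) (~~ far r (q j l) t : nat) <= r.*2)%N.
Proof.
move=> jl; have -> : (\sum_(1 <= l < n.+1) (~~ far r (q j l) t : nat))%N =
    size [seq l <- index_iota 1 n.+1 | ~~ far r (q j l) t].
  rewrite size_filter -sum1_count [RHS]big_mkcond/=.
  by apply: eq_bigr => l _; case: (far _ _ _).
rewrite -(size_map (q j)) -(size_iota (t - r) r.*2); apply: uniq_leq_size.
  rewrite map_inj_in_uniq ?filter_uniq ?iota_uniq// => a b.
  rewrite !mem_filter !mem_index_iota => /and3P[_ a0 _] /and3P[_ b0 _] qab.
  have [ab|ab|//] := ltngtP a b.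
  - by have := q_incr jl a0 ab; rewrite qab ltnn.
  - by have := q_incr jl b0 ab; rewrite qab ltnn.
move=> s /mapP[l]; rewrite mem_filter => /andP[nf _] ->.
by rewrite mem_iota; move: nf; rewrite /far; lia.
Qed.

(** An incompatible [l] is below the threshold [L] of [spaced_times], or one of its [ell] times is
    near one of the [k * ell] times of [A]. The bound depends on neither [n] nor [A]. *)
Lemma count_incompatible r k : exists c : nat, forall A n, size A = k ->
  (\sum_(1 <= l < n.+1) (~~ compatible r l A : nat) <= c)%N.
Proof.
have [L HL] := spaced_times r.
exists (L + ell * (k * ell * r.*2))%N => A n Ak.
apply: (@leq_trans (\sum_(1 <= l < n.+1) ((l < L : nat) +
    \sum_(j < ell) \sum_(t <- times_of A) (~~ far r (q j l) t : nat)))).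
  apply: leq_sum => l _; case: (boolP (compatible _ _ _)) => // nc.
  have [//|Ll] := ltnP l L.
  move: nc; rewrite /compatible HL//= /allrel => /allPn[s sl /allPn[t tA nf]].
  have /mapP[j] := sl; rewrite mem_iota add0n => /= jl sE.
  rewrite (bigD1 (Ordinal jl))//= (big_rem t)//= -sE nf.
  by [].
rewrite big_split/= leq_add//.
  apply: (@leq_trans (\sum_(0 <= l < n.+1) (l < L : nat))).
    by rewrite [leqRHS]big_ltn// leq_addl.
  suff -> : (\sum_(0 <= l < n.+1) (l < L : nat))%N = minn n.+1 L by exact: geq_minr.
  by elim: n.+1 => [|p IH]; [rewrite big_geq|rewrite big_nat_recr//= IH]; lia.
rewrite exchange_big/= -[X in (_ <= X * _)%N](card_ord ell) -sum_nat_const.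
apply: leq_sum => j _; rewrite exchange_big/=.
rewrite -Ak -size_times_of -sum1_size big_distrl/=.
by apply: leq_sum => t _; rewrite mul1n; exact: sum_not_far.
Qed.

(** * Recursive bounds for weighted sums over index sets *)

Section weights.
Variables (R : realFieldType) (x : R).
Hypothesis x01 : 0 <= x <= 1.

Let x0 : 0 <= x. Proof. by case/andP: x01. Qed.

(** There are at most [c] incompatible indices, and each adds at least one new time, hence a factor
    [x]. *)
Lemma sum_incompatible_le r c n A : all (leq 1) A ->
  (\sum_(1 <= l < n.+1) (~~ compatible r l A : nat) <= c)%N ->
  \sum_(1 <= l < n.+1 | all (gtn l) A)
    (~~ compatible r l A)%:R * x ^+ ntimes (l :: A) <= x ^+ ntimes A * (c%:R * x).
Proof.
move=> A1 cle.
apply: (@le_trans _ _ (\sum_(1 <= l < n.+1)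
    (~~ compatible r l A)%:R * (x ^+ ntimes A * x))).
  rewrite [leLHS]big_mkcond !big_nat; apply: ler_sum => l /andP[l0 _].
  case: ifP => [Al|_]; last by rewrite !mulr_ge0// exprn_ge0.
  rewrite ler_wpM2l// -exprSr ler_wiXn2l//; first by case/andP: x01.
  exact: ntimes_cons_gt.
rewrite -mulr_suml -natr_sum [leRHS]mulrCA ler_wpM2r ?mulr_ge0 ?exprn_ge0//.
by rewrite ler_nat.
Qed.

(** At most [n] indices are compatible, and each of them adds exactly [ell] new times. *)
Lemma sum_ntimes_cons_le r c n A : (0 < r)%N -> all (leq 1) A ->
  (\sum_(1 <= l < n.+1) (~~ compatible r l A : nat) <= c)%N ->
  \sum_(1 <= l < n.+1 | all (gtn l) A) x ^+ ntimes (l :: A) <=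
  x ^+ ntimes A * (n%:R * x ^+ ell + c%:R * x).
Proof.
move=> r0 A1 cle; rewrite mulrDr.
apply: le_trans (lerD (lexx _) (sum_incompatible_le A1 cle)).
apply: (@le_trans _ _ (\sum_(1 <= l < n.+1 | all (gtn l) A)
    (x ^+ ntimes A * x ^+ ell +
    (~~ compatible r l A)%:R * x ^+ ntimes (l :: A)))).
  apply: ler_sum => l _; case: (boolP (compatible r l A)) => lA /=.
    by rewrite mul0r addr0 (ntimes_compatible r0 lA) exprD mulrC.
  by rewrite mul1r lerDr mulr_ge0// exprn_ge0.
rewrite big_split/= lerD2r; apply: (@le_trans _ _ (\sum_(1 <= l < n.+1)
    (x ^+ ntimes A * x ^+ ell))).
  rewrite [leLHS]big_mkcond; apply: ler_sum => l _; case: ifP => // _.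
  by rewrite mulr_ge0// exprn_ge0.
by rewrite sumr_const_nat subn1 -[leLHS]mulr_natl mulrCA.
Qed.

Definition weight n k := \sum_(A <- subs n k) x ^+ ntimes A.

Definition bad_weight r n k :=
  \sum_(A <- subs n k) (~~ spaced r (times_of A))%:R * x ^+ ntimes A.

Lemma bad_weight_ge0 r n k : 0 <= bad_weight r n k.
Proof. by apply: sumr_ge0 => A _; rewrite mulr_ge0// exprn_ge0. Qed.

Lemma weight0 n : weight n 0 = 1.
Proof. by rewrite /weight; case: n => [|n] /=; rewrite big_seq1. Qed.

Lemma bad_weight0 r n : bad_weight r n 0 = 0.
Proof. by rewrite /bad_weight; case: n => [|n] /=; rewrite big_seq1 /= mul0r. Qed.

Lemma subs_leq1 n k A : A \in subs n k -> all (leq 1) A.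
Proof. by move=> /subs_range; apply: sub_all => l /andP[]. Qed.

Lemma weightS_le r c n k : (0 < r)%N ->
  (forall A, size A = k ->
    (\sum_(1 <= l < n.+1) (~~ compatible r l A : nat) <= c)%N) ->
  weight n k.+1 <= weight n k * (n%:R * x ^+ ell + c%:R * x).
Proof.
move=> r0 cle; apply: (le_trans (le_sum_subsS n k _)) => [A|].
  exact: exprn_ge0.
rewrite /weight mulr_suml big_seq [leRHS]big_seq; apply: ler_sum => A An.
by apply: sum_ntimes_cons_le r0 (subs_leq1 An) _; exact/cle/(subs_size An).
Qed.

(** If [l :: A] is not spaced, then either [A] is already not spaced or [l] is incompatible with
    [A]; the two terms bound these cases. *)
Lemma bad_weightS_le r c n k : (0 < r)%N ->
  (forall A, size A = k ->
    (\sum_(1 <= l < n.+1) (~~ compatible r l A : nat) <= c)%N) ->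
  bad_weight r n k.+1 <= bad_weight r n k * (n%:R * x ^+ ell + c%:R * x) +
    weight n k * (c%:R * x).
Proof.
move=> r0 cle.
pose F A := (~~ spaced r (times_of A))%:R * x ^+ ntimes A.
apply: (le_trans (@le_sum_subsS _ F n k _)) => [A|].
  by rewrite mulr_ge0// exprn_ge0.
rewrite /bad_weight /weight !mulr_suml -big_split/= big_seq [leRHS]big_seq.
apply: ler_sum => A An.
have A1 := subs_leq1 An; have cA := cle A (subs_size An).
apply: (@le_trans _ _ (\sum_(1 <= l < n.+1 | all (gtn l) A)
  ((~~ spaced r (times_of A))%:R * x ^+ ntimes (l :: A) +
   (~~ compatible r l A)%:R * x ^+ ntimes (l :: A)))).
  apply: ler_sum => l _; rewrite /F spaced_times_of_cons -mulrDl ler_wpM2r//.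
    exact: exprn_ge0.
  by case: (compatible _ _ _); case: (spaced _ _); rewrite /= ?add0r ?addr0 ?lerDl.
rewrite big_split/= lerD//; last exact: sum_incompatible_le.
by rewrite -mulr_sumr -mulrA ler_wpM2l// (sum_ntimes_cons_le r0 A1 cA).
Qed.

End weights.

End times.

(** * Binomial moments *)

Section bonferroni.
Variable R : realFieldType.

Lemma alternating_binomial p J :
  \sum_(j < J.+1) (-1) ^+ j * 'C(p.+1, j)%:R = (-1) ^+ J * 'C(p, J)%:R :> R.
Proof.
elim: J => [|J IH]; first by rewrite big_ord_recl big_ord0 !bin0 addr0.
by rewrite big_ord_recr/= IH binS natrD exprS; ring.
Qed.

(** For [m > 0] the truncated alternating sum has the closed form of [alternating_binomial]. *)
Lemma bonferroni0 m J :
  `|(m == 0)%:R - \sum_(j < J) (-1) ^+ j * 'C(m, j)%:R| <= 'C(m, J)%:R :> R.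
Proof.
case: J => [|J]; first by rewrite big_ord0 subr0 bin0; case: m => [|m] /=;
  rewrite ?normr1// normr0 ler01.
case: m => [|p].
  rewrite big_ord_recl/= bin0 expr0 mul1r big1 ?addr0 ?subrr ?normr0//.
  by move=> j _; rewrite bin0n/= mulr0.
rewrite alternating_binomial sub0r normrN normrM normrX normrN1 expr1n mul1r.
by rewrite ger0_norm// ler_nat binS leq_addl.
Qed.

Lemma bin_trinomial k m j :
  ('C(k + j, k) * 'C(k + m, k + j) = 'C(k + m, k) * 'C(m, j))%N.
Proof.
have [jm|mj] := leqP j m; last first.
  by rewrite (bin_small mj) (@bin_small (k + m) (k + j)) ?ltn_add2l// !muln0.
have e1 := bin_fact (leq_addr j k); have e2 := bin_fact (leq_addr m k).
have e3 := bin_fact jm; have e4 := bin_fact (_ : k + j <= k + m)%N.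
rewrite leq_add2l jm subnDl in e4; have {}e4 := e4 isT.
rewrite addKn in e1; rewrite addKn in e2.
(* Multiplied by this product, both sides become the factorial of [k + m]. *)
have pos : (0 < k`! * (j`! * (m - j)`!))%N by rewrite !muln_gt0 !fact_gt0.
apply/eqP; rewrite -(eqn_pmul2r pos); apply/eqP.
transitivity ((k + m)`!)%N.
  by rewrite -e4 -e1; ring.
by rewrite -e2 -e3; ring.
Qed.

(** For [s = k + m], [bin_trinomial] extracts the factor ['C(s, k)] and leaves the case [k = 0] with
    [m] in place of [s]. *)
Lemma bonferroni s k J :
  `|(s == k)%:R - \sum_(j < J) (-1) ^+ j * ('C(k + j, k) * 'C(s, k + j))%:R|
  <= ('C(k + J, k) * 'C(s, k + J))%:R :> R.
Proof.
have [sk|ks] := ltnP s k.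
  rewrite big1 ?subr0 ?(ltn_eqF sk) ?normr0// => j _.
  by rewrite (@bin_small s) ?muln0 ?mulr0// (leq_trans sk)// leq_addr.
rewrite -(subnKC ks); set m := (s - k)%N.
rewrite -[X in _ == X]addn0 eqn_add2l bin_trinomial natrM.
under eq_bigr do rewrite bin_trinomial natrM mulrCA.
rewrite -mulr_sumr (_ : (m == 0)%:R = 'C(k + m, k)%:R * (m == 0)%:R :> R).
  by rewrite -mulrBr normrM ger0_norm// ler_wpM2l// bonferroni0.
by have [->|] := eqVneq m 0%N; rewrite ?addn0 ?binn ?mul1r ?mulr0.
Qed.

End bonferroni.

(** * Limits of real sequences *)

Section limits.
Variable R : realType.

(** An iterated limit: [J] is chosen first, then [n]. It serves both for the mixing error and for
    the Bonferroni truncation. *)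
Lemma cvg_double_approx (p : nat -> R) (A B : nat -> nat -> R) (Q E : nat -> R) (l : R) :
  (forall J, \forall n \near \oo, `|p n - A J n| <= B J n) ->
  (forall J, A J n @[n --> \oo] --> Q J) ->
  (forall J, B J n @[n --> \oo] --> E J) ->
  Q J @[J --> \oo] --> l -> E J @[J --> \oo] --> (0 : R) ->
  p n @[n --> \oo] --> l.
Proof.
move=> pAB AQ BE Ql E0; apply/cvgrPdist_lt => e e0.
(* Four errors add up: [Q J] to [l], [A J n] to [Q J], [B J n] to [E J], and [E J] to 0. *)
have e4 : 0 < e / 4 by rewrite divr_gt0.
have [J [QJ EJ]] : exists J, `|l - Q J| < e / 4 /\ `|0 - E J| < e / 4.
  have : \forall J \near \oo, `|l - Q J| < e / 4 /\ `|0 - E J| < e / 4.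
    by near=> J; split; near: J; [move/cvgrPdist_lt : Ql|move/cvgrPdist_lt : E0]; exact.
  by case=> N _ /(_ N (leqnn N)); exists N.
have /cvgrPdist_lt/(_ _ e4) AJ := AQ J; have /cvgrPdist_lt/(_ _ e4) BJ := BE J.
near=> n.
have h1 : `|p n - A J n| <= B J n by near: n; exact: pAB.
have h2 : `|Q J - A J n| < e / 4 by near: n.
have h3 : `|E J - B J n| < e / 4 by near: n.
by move: QJ EJ h1 h2 h3; rewrite !ler_norml !ltr_norml; lra.
Unshelve. all: by end_near. Qed.

Variables (ell : nat) (u : nat -> R) (lam : R).
Hypothesis ell_gt0 : (0 < ell)%N.
Hypothesis u01 : forall n, 0 <= u n <= 1.
Hypothesis u_lam : n%:R * u n ^+ ell @[n --> \oo] --> lam.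

Lemma cvg_expr0 : u n ^+ ell @[n --> \oo] --> (0 : R).
Proof.
(* Here [harmonic n] is the inverse of [n + 1]; the added 1 dominates the extra [u n ^+ ell] in
   [(n + 1) * u n ^+ ell]. *)
have H : (n%:R * u n ^+ ell + 1) * harmonic n @[n --> \oo] --> (lam + 1) * 0.
  by apply: cvgM; [apply: cvgD => //; exact: cvg_cst|exact: cvg_harmonic].
rewrite mulr0 in H.
apply: (squeeze_cvgr _ (cvg_cst 0) H); near=> n.
have [u0 u1] := andP (u01 n).
rewrite exprn_ge0//= ler_pdivlMr// mulrC -natr1 mulrDl mul1r lerD2l.
exact: exprn_ile1.
Unshelve. all: by end_near. Qed.

Lemma cvg_base0 : u n @[n --> \oo] --> (0 : R).
Proof.
apply/cvgrPdist_lt => e e0; have ee : 0 < e ^+ ell by exact: exprn_gt0.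
have /cvgrPdist_lt/(_ _ ee) := cvg_expr0; apply: filterS => n.
have [u0 u1] := andP (u01 n).
rewrite !sub0r !normrN !ger0_norm ?exprn_ge0//.
by rewrite ltr_pXn2r// nnegrE// ltW.
Qed.

Lemma cvg_binomial k :
  'C(n, k)%:R * u n ^+ (k * ell) @[n --> \oo] --> lam ^+ k / k`!%:R.
Proof.
elim: k => [|k IH].
  rewrite expr0 fact0 divr1; under eq_fun do rewrite bin0 mul0n expr0 mulr1.
  exact: cvg_cst.
have step n : 'C(n, k.+1)%:R * u n ^+ (k.+1 * ell) =
    'C(n, k)%:R * u n ^+ (k * ell) *
    ((n%:R * u n ^+ ell - k%:R * u n ^+ ell) / k.+1%:R).
  (* The subtraction is real, hence negative for [n < k]; both sides then vanish. *)
  have E : 'C(n, k)%:R * (n%:R - k%:R) = k.+1%:R * 'C(n, k.+1)%:R :> R.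
    rewrite -natrM mul_bin_left natrM mulrC.
    have [kn|nk] := leqP k n; first by rewrite natrB.
    by rewrite bin_small// !mulr0.
  have -> : 'C(n, k.+1)%:R = 'C(n, k)%:R * (n%:R - k%:R) / k.+1%:R :> R.
    by rewrite E mulrC mulKf// pnatr_eq0.
  by rewrite mulSn exprD; ring.
under eq_fun do rewrite step.
rewrite factS natrM exprSr (_ : _ / _ = lam ^+ k / k`!%:R * ((lam - k%:R * 0) / k.+1%:R)).
  apply: cvgM => //; apply: cvgM; last exact: cvg_cst.
  by apply: cvgB => //; apply: cvgM; [exact: cvg_cst|exact: cvg_expr0].
rewrite mulr0 subr0 invfM; ring.
Qed.

End limits.

Lemma integral_sum_indic (R : realType) (dO : measure_display) (Om : measurableType dO)
    (Pr : probability Om R) (I : Type) (r : seq I) (c : I -> R)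
    (E : I -> set Om) : (forall i, 0 <= c i) -> (forall i, measurable (E i)) ->
  (\int[Pr]_w (\sum_(i <- r) c i * \1_(E i) w)%:E =
   (\sum_(i <- r) c i * fine (Pr (E i)))%:E)%E.
Proof.
move=> c0 mE; under eq_integral do rewrite -sumEFin.
rewrite ge0_integral_sum//; last 2 first.
- move=> i; apply/measurable_EFinP; apply: measurable_funM => //.
- by move=> i w _; rewrite lee_fin mulr_ge0.
rewrite -sumEFin; apply: eq_bigr => i _.
under eq_integral do rewrite EFinM.
rewrite ge0_integralZl_EFin//; last exact/measurable_EFinP.
by rewrite integral_indic// setIT EFinM fineK// fin_num_measure.
Qed.

Lemma prod_nat_of_bool (I : Type) (r : seq I) (b : I -> bool) :
  (\prod_(i <- r) (b i : nat))%N = all b r.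
Proof.
elim: r => [|i r IH]; first by rewrite big_nil.
by rewrite big_cons IH /=; case: (b i); rewrite ?mul1n ?mul0n.
Qed.

(** * Convergence of the moments and of the law of the sums *)

Section main.
Context (R : realType) (d : measure_display) (M : measurableType d).
Variables (P : R.-pker M ~> M) (m : probability M R) (n0 : nat) (C : R)
  (mu : probability M R) (ell : nat) (q : nat -> nat -> nat) (Gam : nat -> set M)
  (lam : R).
Context (dO : measure_display) (Om : measurableType dO).
Variables (Pr : probability Om R) (nu : probability M R) (X : nat -> Om -> M).
Hypothesis C_gt0 : 0 < C.
Hypothesis P_le : forall x B, measurable B -> (P x B <= C%:E * m B)%E.
Hypothesis P_ge :
  forall x B, measurable B -> ((C^-1)%:E * m B <= nstep P n0 x B)%E.
Hypothesis mu_inv : invariant_prob P mu.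
Hypothesis ell_gt0 : (0 < ell)%N.
Hypothesis q_incr : forall j, (j < ell)%N ->
  forall a b, (0 < a)%N -> (a < b)%N -> (q j a < q j b)%N.
Hypothesis q0_ge : forall l, (0 < l)%N -> (l <= q 0 l)%N.
Hypothesis q_lt : forall j l, (0 < l)%N -> (j.+1 < ell)%N -> (q j l < q j.+1 l)%N.
Hypothesis q_gap : forall j, (j.+1 < ell)%N -> forall N : nat, exists L : nat,
  forall l, (L <= l)%N -> (N <= q j.+1 l - q j l)%N.
Hypothesis mGam : forall n, measurable (Gam n).
Hypothesis mu_lam : n%:R * fine (mu (Gam n)) ^+ ell @[n --> \oo] --> lam.
Hypothesis mcX : markov_chain Pr P nu X.

Lemma bad_weight_cvg0 (x : nat -> R) (Lam : R) r k : (0 < r)%N ->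
  (forall n, 0 <= x n) -> x n @[n --> \oo] --> (0 : R) ->
  n%:R * x n ^+ ell @[n --> \oo] --> Lam ->
  bad_weight ell q (x n) r n k @[n --> \oo] --> (0 : R).
Proof.
move=> r0 x_ge0 x_cvg0 x_Lam.
have x1 : \forall n \near \oo, x n <= 1.
  have /cvgrPdist_lt/(_ _ ltr01) := x_cvg0; apply: filterS => n.
  by rewrite sub0r normrN ger0_norm// => /ltW.
(* The two recursions are iterated on majorants [W] and [B] with known limits: the weights
   themselves are only bounded above, and the bad weight of size [k.+1] involves the weight of size
   [k]. *)
suff [W [B [_ B0 WB]]] : exists W B : nat -> R,
    [/\ W n @[n --> \oo] --> Lam ^+ k, B n @[n --> \oo] --> (0 : R) &
    \forall n \near \oo, weight ell q (x n) n k <= W n /\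
      bad_weight ell q (x n) r n k <= B n].
  apply: (squeeze_cvgr _ (cvg_cst 0) B0); near=> n; apply/andP; split.
    apply: bad_weight_ge0; rewrite x_ge0/=; near: n; exact: x1.
  by have [] : weight ell q (x n) n k <= W n /\
    bad_weight ell q (x n) r n k <= B n by near: n.
elim: k => [|k [W [B [WL B0 WB]]]].
  exists (fun=> 1), (fun=> 0); split; [exact: cvg_cst|exact: cvg_cst|].
  by near=> n; rewrite weight0 bad_weight0.
have [c cP] := count_incompatible ell_gt0 q_incr q0_ge q_lt q_gap r k.
have cx0 : c%:R * x n @[n --> \oo] --> (0 : R).
  by rewrite -[X in _ --> X](mulr0 c%:R); apply: cvgM => //; exact: cvg_cst.
have fac : n%:R * x n ^+ ell + c%:R * x n @[n --> \oo] --> Lam.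
  by rewrite -[X in _ --> X]addr0; exact: cvgD.
exists (fun n => W n * (n%:R * x n ^+ ell + c%:R * x n)),
  (fun n => B n * (n%:R * x n ^+ ell + c%:R * x n) + W n * (c%:R * x n)); split.
- by rewrite exprSr; exact: cvgM.
- by have := cvgD (cvgM B0 fac) (cvgM WL cx0); rewrite mul0r mulr0 addr0; exact.
near=> n.
have x01 : 0 <= x n <= 1 by rewrite x_ge0/=; near: n.
have [Wn Bn] : weight ell q (x n) n k <= W n /\
    bad_weight ell q (x n) r n k <= B n by near: n.
have f0 : 0 <= n%:R * x n ^+ ell + c%:R * x n.
  by rewrite addr_ge0// mulr_ge0// exprn_ge0.
have cP' A : size A = k -> (\sum_(1 <= l < n.+1) (~~ compatible ell q r l A : nat) <= c)%N.
  by move=> Ak; exact: cP.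
split.
  apply: le_trans (weightS_le ell_gt0 q_incr q_lt x01 r0 cP') _.
  by rewrite ler_wpM2r.
apply: le_trans (bad_weightS_le ell_gt0 q_incr q_lt x01 r0 cP') _.
by rewrite lerD// ler_wpM2r// mulr_ge0.
Unshelve. all: by end_near. Qed.

Let u n : R := fine (mu (Gam n)).
Let x n : R := C ^+ 2 * u n.
Let dlt : R := (C ^+ 2)^-1.

Let u01 n : 0 <= u n <= 1.
Proof.
rewrite /u fine_ge0//= -lee_fin fineK; first exact: probability_le1.
exact: fin_num_measure.
Qed.

Let C2_ge1 : 1 <= C ^+ 2.
Proof. by rewrite exprn_ege1// (C_ge1 P_le mu_inv). Qed.

Let u_le_x n : u n <= x n.
Proof. by rewrite /x ler_peMl//; case/andP: (u01 n). Qed.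

Let x_ge0 n : 0 <= x n.
Proof. by apply: le_trans (u_le_x n); case/andP: (u01 n). Qed.

Lemma nstep1_le n y : fine (nstep P 1 y (Gam n)) <= x n.
Proof.
rewrite -lee_fin fineK ?nstep_fin_num// /x /u EFinM fineK; last exact: fin_num_measure.
by rewrite nstep1//; exact: (P_le_mu C_gt0 P_le P_ge mu_inv y (mGam n)).
Qed.

(** The expectation of ['C(S_n, k)], as [momentE] makes precise. *)
Definition moment n k := \sum_(A <- subs n k) phit Pr X (Gam n) (times_of ell q A).

(** Spaced sets, with gap [(K * n0).+1], are handled by [phit_spaced] and mixing. For the others,
    [phit] and [u n ^+ (k * ell)] are each at most [x n ^+ ntimes A], whence the factor 2. *)
Lemma moment_approx K n k :
  x n <= 1 ->
  `|moment n k - 'C(n, k)%:R * u n ^+ (k * ell)| <=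
  ((1 + (1 - dlt) ^+ K * C ^+ 2) ^+ (k * ell) - 1) *
    ('C(n, k)%:R * u n ^+ (k * ell)) +
  2 * bad_weight ell q (x n) (K * n0).+1 n k.
Proof.
move=> x1; set e := (1 - dlt) ^+ K * C ^+ 2; set r := (K * n0).+1.
have [u0 u1] := andP (u01 n).
have e0 : 0 <= e.
  rewrite mulr_ge0// ?exprn_ge0 ?(ltW C_gt0)// subr_ge0 invf_le1//.
  exact: lt_le_trans C2_ge1.
have -> : 'C(n, k)%:R * u n ^+ (k * ell) = \sum_(A <- subs n k) u n ^+ (k * ell).
  by rewrite big_const_seq count_predT size_subs iter_addr_0 mulr_natl.
rewrite -sumrB (le_trans (ler_norm_sum _ _ _))// /bad_weight !mulr_sumr -big_split/=.
rewrite big_seq [leRHS]big_seq; apply: ler_sum => A An.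
have sA : size (times_of ell q A) = (k * ell)%N.
  by rewrite size_times_of (subs_size An).
have tA : all (leq 1) (times_of ell q A).
  by apply: times_of_gt0 => //; exact: subs_leq1 An.
case: (boolP (spaced r _)) => sp /=.
  rewrite mul0r mulr0 addr0 -sA.
  apply: (phit_spaced mcX (mGam n) u0 e0 _ _ sp) => // j y rj.
  exact: (nstep_mixing C_gt0 P_le P_ge mu_inv (mGam n)).
have pT := phit_le mcX (mGam n) (@nstep1_le n) tA.
have uT : u n ^+ (k * ell) <= x n ^+ ntimes ell q A.
  apply: (@le_trans _ _ (x n ^+ (k * ell))).
    by apply: lerXn2r; rewrite ?nnegrE.
  by apply: ler_wiXn2l => //; rewrite -(subs_size An); exact: ntimes_le.
have p0 := phit_ge0 Pr X (Gam n) (times_of ell q A).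
have uu : 0 <= u n ^+ (k * ell) by exact: exprn_ge0.
have ee : 0 <= ((1 + e) ^+ (k * ell) - 1) * u n ^+ (k * ell).
  by rewrite mulr_ge0// subr_ge0 exprn_ege1// lerDl.
by rewrite ler_norml mul1r; move: pT; rewrite -/(ntimes ell q A); lra.
Qed.

Lemma moment_cvg k : moment n k @[n --> \oo] --> lam ^+ k / k`!%:R.
Proof.
have x_cvg0 : x n @[n --> \oo] --> (0 : R).
  rewrite -[X in _ --> X](mulr0 (C ^+ 2)); apply: cvgM; first exact: cvg_cst.
  exact: cvg_base0 ell_gt0 u01 mu_lam.
have x_Lam : n%:R * x n ^+ ell @[n --> \oo] --> (C ^+ 2) ^+ ell * lam.
  under eq_fun do rewrite /x exprMn mulrCA.
  by apply: cvgM => //; exact: cvg_cst.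
have a_cvg := cvg_binomial (k := k) u01 mu_lam.
pose e K : R := (1 + (1 - dlt) ^+ K * C ^+ 2) ^+ (k * ell) - 1.
(* For fixed [K] the bad weight vanishes as [n] grows; afterwards [e K] tends to 0 since
   [0 <= 1 - dlt < 1]. *)
apply: (@cvg_double_approx _ (moment^~ k) (fun _ n => 'C(n, k)%:R * u n ^+ (k * ell))
  (fun K n => e K * ('C(n, k)%:R * u n ^+ (k * ell)) +
    2 * bad_weight ell q (x n) (K * n0).+1 n k)
  (fun=> lam ^+ k / k`!%:R) (fun K => e K * (lam ^+ k / k`!%:R) + 2 * 0)
  (lam ^+ k / k`!%:R)).
- move=> K; near=> n; apply: moment_approx.
  near: n; have /cvgrPdist_lt/(_ _ ltr01) := x_cvg0; apply: filterS => n.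
  by rewrite sub0r normrN ger0_norm// => /ltW.
- by move=> _.
- move=> K; apply: cvgD; (apply: cvgM; first exact: cvg_cst) => //.
  exact: bad_weight_cvg0 x_Lam.
- exact: cvg_cst.
rewrite -[X in _ --> X](addr0 0) -[X in _ --> X + _](mul0r (lam ^+ k / k`!%:R)).
rewrite -[X in _ --> _ + X](mulr0 2).
apply: cvgD; last exact: cvg_cst.
apply: cvgM; last exact: cvg_cst.
rewrite -[X in _ --> X](subrr 1) -[X in _ --> X - _](expr1n _ (k * ell)).
apply: cvgB; last exact: cvg_cst.
apply: (@continuous_cvg _ _ _ _ _ (fun K => 1 + (1 - dlt) ^+ K * C ^+ 2)
  (fun z : R => z ^+ (k * ell)) 1).
  exact: exprn_continuous.
rewrite -[X in _ --> X](addr0 1); apply: cvgD; first exact: cvg_cst.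
rewrite -[X in _ --> X](mul0r (C ^+ 2)); apply: cvgM; last exact: cvg_cst.
apply: cvg_expr; rewrite ger0_norm.
  by rewrite ltrBlDr ltrDl invr_gt0; exact: lt_le_trans C2_ge1.
by rewrite subr_ge0 invf_le1//; exact: lt_le_trans C2_ge1.
Unshelve. all: by end_near. Qed.

Let visits n l w := all (fun t => X t w \in Gam n) (times ell q l).

Lemma SsumE n w :
  Ssum X ell q Gam n w = (\sum_(1 <= l < n.+1) (visits n l w : nat))%N.
Proof.
apply: eq_bigr => l _; rewrite -prod_nat_of_bool /times big_map.
by rewrite -[X in iota _ X]subn0 big_mkord.
Qed.

Lemma in_hit_times n A w :
  (w \in hit X (Gam n) (times_of ell q A)) = all (fun l => visits n l w) A.
Proof.
apply/idP/allP => [/set_mem wA l lA|wA]; last first.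
  apply/mem_set => t /flattenP[s /mapP[l lA ->] tl].
  by have /allP/(_ t tl)/set_mem := wA l lA.
apply/allP => t tl; apply/mem_set/wA/flattenP.
by exists (times ell q l) => //; exact: map_f.
Qed.

Lemma binomial_Ssum n k w : 'C(Ssum X ell q Gam n w, k)%:R =
  \sum_(A <- subs n k) 1 * \1_(hit X (Gam n) (times_of ell q A)) w :> R.
Proof.
rewrite SsumE -sum_prod_subs natr_sum; apply: eq_bigr => A _.
by rewrite mul1r indicE in_hit_times prod_nat_of_bool.
Qed.

Lemma Ssum_le n w : (Ssum X ell q Gam n w <= n)%N.
Proof.
rewrite SsumE -[leqRHS]muln1 -[n in leqRHS](subn1 n.+1) -sum_nat_const_nat.
by apply: leq_sum => l _; case: (visits _ _ _).
Qed.

Lemma measurable_Ssum_eq n s : measurable [set w | Ssum X ell q Gam n w = s].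
Proof.
(* The first binomial coefficient is the sum itself, already written as a sum of indicators. *)
pose f w : R := 'C(Ssum X ell q Gam n w, 1)%:R.
have mf : measurable_fun setT f.
  rewrite (_ : f = fun w => \sum_(A <- subs n 1)
      1 * \1_(hit X (Gam n) (times_of ell q A)) w); last first.
    by apply/funext => w; exact: binomial_Ssum.
  apply: measurable_sum => A; apply: measurable_funM => //.
  by apply: measurable_indic; exact: measurable_hit mcX _ (mGam n) _.
rewrite (_ : [set _ | _] = f @^-1` [set s%:R]).
  by rewrite -[_ @^-1` _]setTI; exact: mf.
apply/seteqP; split=> w; rewrite /f /= bin1; first by move=> ->.
by move=> /eqP; rewrite eqr_nat => /eqP.
Qed.

Let pS n s : R := fine (Pr [set w | Ssum X ell q Gam n w = s]).

(** The integral of ['C(S_n, k)] is computed twice, over index sets and over the values [s <= n] of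
    the sum. *)
Lemma momentE n k : moment n k = \sum_(s < n.+1) 'C(s, k)%:R * pS n s.
Proof.
apply: EFin_inj.
rewrite -(@integral_sum_indic _ _ _ Pr _ _ (fun s : 'I_n.+1 => 'C(s, k)%:R)
  (fun s => [set w | Ssum X ell q Gam n w = s])) => [|//|s]; last first.
  exact: measurable_Ssum_eq.
transitivity (\int[Pr]_w (\sum_(A <- subs n k)
    1 * \1_(hit X (Gam n) (times_of ell q A)) w)%:E)%E.
  rewrite integral_sum_indic//; last by move=> A; exact: measurable_hit mcX _ (mGam n) _.
  by congr EFin; apply: eq_bigr => A _; rewrite mul1r.
apply: eq_integral => w _; rewrite -binomial_Ssum; congr EFin.
have Sn : (Ssum X ell q Gam n w < n.+1)%N by rewrite ltnS Ssum_le.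
rewrite (bigD1 (Ordinal Sn))//= big1 ?addr0.
  by rewrite indicE mem_set// mulr1.
move=> s; rewrite -val_eqE /= => sS; rewrite indicE memNset ?mulr0//= => E.
by rewrite E eqxx in sS.
Qed.

(** The pointwise inequality [bonferroni] is averaged over the law of the sum. *)
Lemma Ssum_bonferroni n k J :
  `|pS n k - \sum_(j < J) (-1) ^+ j * 'C(k + j, k)%:R * moment n (k + j)| <=
  'C(k + J, k)%:R * moment n (k + J).
Proof.
have pSE : pS n k = \sum_(s < n.+1) (nat_of_ord s == k)%:R * pS n s.
  have [kn|nk] := ltnP k n.+1.
    rewrite (bigD1 (Ordinal kn))//= eqxx mul1r big1 ?addr0// => s.
    by rewrite -val_eqE /= => /negbTE ->; rewrite mul0r.
  rewrite big1 => [|s _]; last by rewrite ltn_eqF ?mul0r// (leq_trans _ nk).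
  rewrite /pS (_ : [set _ | _] = set0) ?measure0//.
  apply/seteqP; split=> // w /= Sk.
  by have := Ssum_le n w; rewrite Sk leqNgt nk.
have -> : \sum_(j < J) (-1) ^+ j * 'C(k + j, k)%:R * moment n (k + j) =
    \sum_(s < n.+1) (\sum_(j < J) (-1) ^+ j * ('C(k + j, k) * 'C(s, k + j))%:R) * pS n s.
  under eq_bigr do rewrite momentE mulr_sumr.
  rewrite exchange_big/=; apply: eq_bigr => s _; rewrite mulr_suml.
  by apply: eq_bigr => j _; rewrite natrM !mulrA.
rewrite pSE -sumrB (le_trans (ler_norm_sum _ _ _))// momentE mulr_sumr.
apply: ler_sum => s _; rewrite -mulrBl normrM mulrA -natrM.
rewrite (@ger0_norm _ (pS n s)) ?fine_ge0//.
by rewrite ler_wpM2r ?fine_ge0// bonferroni.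
Qed.

Lemma Ssum_cvg k : pS n k @[n --> \oo] --> expR (- lam) * lam ^+ k / (k`!)%:R.
Proof.
(* This factorization makes the limits of the alternating sums the partial sums of the series of
   [expR (- lam)], and the error bounds its terms in absolute value, up to the common factor
   [lam ^+ k / k!]. *)
have coef j : 'C(k + j, k)%:R * (lam ^+ (k + j) / (k + j)`!%:R) =
    lam ^+ k / k`!%:R * (lam ^+ j / j`!%:R).
  have := bin_fact (leq_addr j k); rewrite addKn => <-.
  rewrite !natrM exprD; field.
  by rewrite !pnatr_eq0 -!lt0n !fact_gt0 bin_gt0 leq_addr.
apply: (@cvg_double_approx _ (pS^~ k)
  (fun J n => \sum_(j < J) (-1) ^+ j * 'C(k + j, k)%:R * moment n (k + j))
  (fun J n => 'C(k + J, k)%:R * moment n (k + J))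
  (fun J => lam ^+ k / k`!%:R * series (exp_coeff (- lam)) J)
  (fun J => lam ^+ k / k`!%:R * exp_coeff lam J)
  (expR (- lam) * lam ^+ k / (k`!)%:R)).
- by move=> J; near=> n; exact: Ssum_bonferroni.
- move=> J; rewrite /series/= big_mkord mulr_sumr.
  apply: cvg_big => [|j _]; first exact: add_continuous.
  rewrite [X in _ --> X](_ : _ =
      (-1) ^+ j * 'C(k + j, k)%:R * (lam ^+ (k + j) / (k + j)`!%:R)).
    by apply: cvgM; [exact: cvg_cst|exact: moment_cvg].
  by rewrite -[RHS]mulrA coef /exp_coeff /= (exprNn lam); ring.
- move=> J; rewrite -coef; apply: cvgM; [exact: cvg_cst|exact: moment_cvg].
- rewrite -mulrA [X in _ --> X]mulrC; apply: cvgM; first exact: cvg_cst.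
  exact: is_cvg_series_exp_coeff.
rewrite -[X in _ --> X](mulr0 (lam ^+ k / k`!%:R)); apply: cvgM; first exact: cvg_cst.
exact: cvg_exp_coeff.
Unshelve. all: by end_near. Qed.

End main.

Unset Implicit Arguments.

Theorem theorem2p2 (R : realType) (d : measure_display) (M : measurableType d)
    (P : R.-pker M ~> M) (m : probability M R) (n0 : nat) (C : R)
    (mu : probability M R)
    (ell : nat) (q : nat -> nat -> nat) (Gam : nat -> set M) (lam : R)
    (dO : measure_display) (Om : measurableType dO) (Pr : probability Om R)
    (nu : probability M R) (X : nat -> Om -> M) :
  (1 <= n0)%N -> 0 < C ->
  (forall x B, measurable B -> (P x B <= C%:E * m B)%E) ->
  (forall x B, measurable B -> ((C^-1)%:E * m B <= nstep P n0 x B)%E) ->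
  invariant_prob P mu ->
  (1 <= ell)%N ->
  (forall j, (j < ell)%N -> forall a b, (0 < a)%N -> (a < b)%N -> (q j a < q j b)%N) ->
  (forall l, (0 < l)%N -> (l <= q 0%N l)%N) ->
  (forall j l, (0 < l)%N -> (j.+1 < ell)%N -> (q j l < q j.+1 l)%N) ->
  (forall j, (j.+1 < ell)%N -> forall N : nat, exists L : nat,
      forall l, (L <= l)%N -> (N <= q j.+1 l - q j l)%N) ->
  (forall n, measurable (Gam n)) ->
  0 < lam ->
  (fun n : nat => n%:R * fine (mu (Gam n)) ^+ ell) @ \oo --> lam ->
  markov_chain Pr P nu X ->
  forall k : nat,
    (fun n : nat => fine (Pr [set w | Ssum X ell q Gam n w = k])) @ \oo -->
      expR (- lam) * lam ^+ k / (k`!)%:R.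
Proof.
move=> n0_gt0 C_gt0 P_le P_ge mu_inv ell_gt0 q_incr q0_ge q_lt q_gap mGam _ mu_lam mcX.
exact: (Ssum_cvg C_gt0 P_le P_ge mu_inv ell_gt0 q_incr q0_ge q_lt q_gap mGam mu_lam mcX).
Qed.
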